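(* Let $p\in\mathbb{R}$ and $q>0$, and let $\mathcal{H}:[0,+\infty)\to\mathbb{R}$ be continuous on $[0,+\infty)$ and differentiable on $(0,+\infty)$. Assume that $\mathcal{H}$ is nonnegative, strictly increasing and convex on $[0,+\infty)$. Consider the problem $$\min_{\gamma\ge 0}\ \mathcal{L}(\gamma)=-\frac12\frac{p^2\gamma}{1+q\gamma}+\frac12\log(1+q\gamma)+\mathcal{H}(\gamma)$$ and its KKT conditions $$\frac12\frac{q^2\gamma+(q-p^2)}{(1+q\gamma)^2}+\mathcal{H}'(\gamma)-\mu=0,\qquad \mu\ge0,\ \gamma\ge0,\qquad \mu\gamma=0 .$$ Then any $\gamma^\star$ for which there is a multiplier $\mu$ such that $(\gamma^\star,\mu)$ satisfies these KKT conditions is a local minimizer of the problem, i.e. a local minimizer of $\mathcal{L}$ over $[0,+\infty)$.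
   Context: At $\gamma=0$ the term $\mathcal{H}'(\gamma)$ in the KKT conditions is read as $\mathcal{H}'(0^+)=\lim_{\gamma\to0^+}\mathcal{H}'(\gamma)$, which exists and is finite and nonnegative under the hypotheses. *)

(* Defs.v *)
From mathcomp Require Import all_boot all_order all_algebra.
From mathcomp Require Import all_classical all_reals all_analysis.

Set Implicit Arguments.
Unset Strict Implicit.
Unset Printing Implicit Defensive.

Import Order.TTheory GRing.Theory Num.Theory numFieldNormedType.Exports.

Local Open Scope classical_set_scope.
Local Open Scope ring_scope.

Definition objective (R : realType) (p q : R) (H : R -> R) (g : R) : R :=
  - (1 / 2) * (p ^+ 2 * g / (1 + q * g)) + 1 / 2 * ln (1 + q * g) + H g.

(* [H] is only meaningful on [0, +oo[, so its slope at 0 is H'(0+). For the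
   convex nondecreasing [H] at hand the limit exists, is finite and >= 0, so
   [lim] does not take its default value. *)
Definition slope (R : realType) (H : R -> R) (g : R) : R :=
  if g == 0 then lim (derive1 H x @[x --> 0^'+]) else derive1 H g.

Definition kkt (R : realType) (p q : R) (H : R -> R) (g mu : R) : Prop :=
  [/\ 1 / 2 * ((q ^+ 2 * g + (q - p ^+ 2)) / (1 + q * g) ^+ 2)
        + slope H g - mu = 0,
      0 <= mu, 0 <= g & mu * g = 0].

Definition local_minimizer_on (R : realType) (D : set R) (f : R -> R) (x : R) :
  Prop :=
  D x /\ \forall y \near within D (nbhs x), f x <= f y.

(* Main.v *)
(** Let [phi] be the objective without [H]. With [t = q (y - g) / (1 + q g)] and
    [c = p^2 / (q (1 + q g))],
      [phi y - phi g - phi'(g) (y - g) = (c t^2 / (1 + t) + ln (1 + t) - t) / 2],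
    and [phi'(g) <= 0] means [1 <= c]; as [t / (1 + t) <= ln (1 + t)], [phi] then
    lies above its tangent at [g] on all of [0, +oo[. Adding the tangent
    inequality for the convex [H] and using stationarity, the objective at [y]
    exceeds the one at [g] by at least [mu (y - g) = mu y >= 0].
    If [phi'(g) > 0], then [mu > 0], so [g = 0], where [p^2 < q] and the same
    logarithm bound gives [phi y >= 0 = phi 0], while [H] increases. So KKT points
    are in fact global minimizers. *)
Require Import Defs.
From mathcomp Require Import all_boot all_order all_algebra.
From mathcomp Require Import all_classical all_reals all_analysis.
From mathcomp Require Import ring lra.

Set Implicit Arguments.
Unset Strict Implicit.
Unset Printing Implicit Defensive.

Import Order.TTheory GRing.Theory Num.Theory numFieldNormedType.Exports.

Local Open Scope classical_set_scope.
Local Open Scope ring_scope.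

(** The bound [ln (1 + x) <= x] at [x = u^-1 - 1]. *)
Lemma ln_ge1BV (R : realType) (u : R) : 0 < u -> 1 - u^-1 <= ln u.
Proof.
move=> u0; have := @le_ln1Dx R (u^-1 - 1).
rewrite ltrBrDl subrr invr_gt0 => /(_ u0).
by rewrite addrC subrK lnV ?posrE//; lra.
Qed.

(** By convexity the difference quotient of [f] at [a] along [b - a], with step [t] in []0, 1]], is
    at most [f b - f a]; let [t] tend to 0. *)
Lemma convex_tangent_le (R : realType) (D : set R) (f : R -> R) (a b : R) :
    convex_function (D : set R^o) f -> D a -> D b -> derivable f a 1 ->
  f a + derive1 f a * (b - a) <= f b.
Proof.
move=> cf Da Db /derivable1_diffP df.
have -> : derive1 f a * (b - a) = 'D_(b - a) f a.
  rewrite derive1E deriveE// deriveE// mulrC.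
  by rewrite -[in RHS](mulr1 (b - a)) [RHS]linearZ.
rewrite addrC -lerBrDr.
have /cvg_dnbhs_at_right := @diff_derivable _ _ _ f a (b - a) df.
move/cvgr_to_le; apply; near=> t.
have t0 : 0 < t by [].
have t1 : t <= 1 by near: t; exact: nbhs_right_le.
rewrite /= ler_pdivrMl//.
have := cf (Itv01 (ltW t0) t1) b a; rewrite !inE => /(_ Db Da).
rewrite !convRE /=.
rewrite /unstable.onem [X in f X <= _](_ : _ = t *: (b - a) + a); first by lra.
by transitivity (t * b + (1 - t) * a) => //; rewrite -[t *: _]/(t * _); ring.
Unshelve. all: by end_near. Qed.

Section ConvexRightSlope.
Variables (R : realType) (f : R -> R).
Hypothesis f_cont : {within `[0, +oo[, continuous f}.
Hypothesis f_diff : forall x : R, 0 < x -> derivable f x 1.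
Hypothesis f_incr : {in `[0, +oo[ &, {homo f : x y / x < y}}.
Hypothesis f_conv : convex_function (`[0, +oo[ : set R^o) f.

Let tangent (x y : R) : 0 < x -> 0 <= y -> f x + derive1 f x * (y - x) <= f y.
Proof.
move=> x0 y0; apply: (convex_tangent_le f_conv); last exact: f_diff.
- by rewrite /= in_itv/= andbT ltW.
- by rewrite /= in_itv/= andbT.
Qed.

Lemma derive1_convex_ge0 (x : R) : 0 < x -> 0 <= derive1 f x.
Proof.
move=> x0; have : f 0 < f x.
  by apply: f_incr; rewrite ?in_itv/= ?lexx ?andbT// ltW.
by rewrite -(pmulr_lge0 _ x0); have := tangent x0 (lexx 0); lra.
Qed.

Lemma derive1_convex_nd (x y : R) :
  0 < x -> x <= y -> derive1 f x <= derive1 f y.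
Proof.
rewrite le_eqVlt => x0 /orP[/eqP->//|xy].
have y0 := lt_trans x0 xy.
have yx : 0 < y - x by rewrite subr_gt0.
(* Add the tangent inequality at [x] evaluated at [y] to the one at [y] evaluated at [x]. *)
rewrite -(ler_pM2r yx).
by have := tangent x0 (ltW y0); have := tangent y0 (ltW x0); lra.
Qed.

(** The derivative is nondecreasing and bounded below by 0 on the positive axis. Hence the [lim] in
    [slope] is a genuine limit. *)
Lemma derive1_convex_cvg : cvg (derive1 f x @[x --> 0^'+]).
Proof.
apply: nondecreasing_at_right_is_cvgr; near=> b.
- move=> x y; rewrite !in_itv/= => /andP[x0 _] _.
  exact: derive1_convex_nd.
- exists 0 => _ [x + <-]; rewrite /= in_itv/= => /andP[x0 _].
  exact: derive1_convex_ge0.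
Unshelve. all: by end_near. Qed.

Lemma slope_tangent_le (x y : R) : 0 <= x -> 0 <= y ->
  f x + slope f x * (y - x) <= f y.
Proof.
rewrite /slope; case: ltgtP => // [x0 _ y0|<- _ y0]; first exact: tangent.
(* At [x = 0], pass to the limit in the tangent inequality at [z > 0], by right continuity of [f] at
   0. *)
have [_ f0] := (continuous_within_itvcyP 0 f).1 f_cont.
have cvgT : (f z + derive1 f z * (y - z)) @[z --> 0^'+] -->
    f 0 + lim (derive1 f z @[z --> 0^'+]) * (y - 0).
  apply: cvgD => //; apply: cvgM; first exact: derive1_convex_cvg.
  by apply: cvgB; [exact: cvg_cst|exact: cvg_at_right_filter cvg_id].
apply: (cvgr_to_le cvgT); near=> z; exact: tangent.
Unshelve. all: by end_near. Qed.

End ConvexRightSlope.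

Lemma smooth_part_tangent_le (R : realType) (p q g y : R) :
    0 < q -> 0 <= g -> 0 <= y -> q * (1 + q * g) <= p ^+ 2 ->
  let phi x :=
    - (1 / 2) * (p ^+ 2 * x / (1 + q * x)) + 1 / 2 * ln (1 + q * x) in
  phi g + 1 / 2 * ((q ^+ 2 * g + (q - p ^+ 2)) / (1 + q * g) ^+ 2) * (y - g)
  <= phi y.
Proof.
move=> q0 g0 y0 hp /=.
have a0 : 0 < 1 + q * g by rewrite ltr_pwDl// mulr_ge0// ltW.
have b0 : 0 < 1 + q * y by rewrite ltr_pwDl// mulr_ge0// ltW.
have := ln_ge1BV (divr_gt0 b0 a0).
rewrite ln_div ?posrE// invf_div => hln.
rewrite -subr_ge0.
(* Since [t - t / (1 + t) = t^2 / (1 + t)], the gap is half of [(c - 1) t^2 / (1 + t)], the term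
   here, plus half of [ln (1 + t) - t / (1 + t)], which is [hln]. *)
have : 0 <= 1 / 2 * (p ^+ 2 - q * (1 + q * g)) * q * (y - g) ^+ 2
    / ((1 + q * g) ^+ 2 * (1 + q * y)).
  have den : 0 <= (1 + q * g) ^+ 2 * (1 + q * y).
    by rewrite mulr_ge0 ?sqr_ge0 ?ltW.
  apply: divr_ge0 den; apply: mulr_ge0 (sqr_ge0 _).
  by apply: mulr_ge0 (ltW q0); apply: mulr_ge0; rewrite ?subr_ge0.
move=> h.
have -> : - (1 / 2) * (p ^+ 2 * y / (1 + q * y)) + 1 / 2 * ln (1 + q * y)
  - (- (1 / 2) * (p ^+ 2 * g / (1 + q * g)) + 1 / 2 * ln (1 + q * g)
  + 1 / 2 * ((q ^+ 2 * g + (q - p ^+ 2)) / (1 + q * g) ^+ 2) * (y - g))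
  = 1 / 2 * (p ^+ 2 - q * (1 + q * g)) * q * (y - g) ^+ 2
    / ((1 + q * g) ^+ 2 * (1 + q * y))
   + 1 / 2 * (ln (1 + q * y) - ln (1 + q * g)
     - (1 - (1 + q * g) / (1 + q * y))).
  by field; rewrite ?gt_eqF.
by lra.
Qed.

Lemma smooth_part_ge0 (R : realType) (p q y : R) :
    0 < q -> 0 <= y -> p ^+ 2 <= q ->
  0 <= - (1 / 2) * (p ^+ 2 * y / (1 + q * y)) + 1 / 2 * ln (1 + q * y).
Proof.
move=> q0 y0 hp.
have b0 : 0 < 1 + q * y by rewrite ltr_pwDl// mulr_ge0// ltW.
have := ln_ge1BV b0.
have -> : 1 - (1 + q * y)^-1 = q * y / (1 + q * y) by field; rewrite gt_eqF.
have : p ^+ 2 * y / (1 + q * y) <= q * y / (1 + q * y).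
  by rewrite ler_pM2r ?invr_gt0// ler_wpM2r.
by lra.
Qed.

Theorem theorem3p4 (R : realType) (p q : R) (H : R -> R)
    (q_gt0 : 0 < q)
    (H_cont : {within `[0, +oo[, continuous H})
    (H_diff : forall x : R, 0 < x -> derivable H x 1)
    (H_ge0 : forall x : R, 0 <= x -> 0 <= H x)
    (H_incr : {in `[0, +oo[ &, {homo H : x y / x < y}})
    (H_conv : convex_function (`[0, +oo[ : set R^o) H)
    (g : R) (kkt_g : exists mu : R, kkt p q H g mu) :
  local_minimizer_on `[0, +oo[ (objective p q H) g.
Proof.
case: kkt_g => mu [stat mu0 g0 mug].
split; first by rewrite /= in_itv/= andbT.
suff glob y : 0 <= y -> objective p q H g <= objective p q H y.
  rewrite near_withinE; apply: nearW => y.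
  by rewrite /= in_itv/= andbT; exact: glob.
move=> y0.
have a0 : 0 < 1 + q * g by rewrite ltr_pwDl// mulr_ge0// ltW.
(* The numerator of [phi'(g)] is [q * (1 + q * g) - p ^+ 2], so this splits on its sign. *)
have [hp|hp] := leP (q * (1 + q * g)) (p ^+ 2).
  have /= := smooth_part_tangent_le q_gt0 g0 y0 hp.
  have := slope_tangent_le H_cont H_diff H_incr H_conv g0 y0.
  have : 0 <= mu * (y - g) by rewrite mulrBr mug subr0 mulr_ge0.
  rewrite /objective; move: stat.
  set d := 1 / 2 * _; set s := slope H g => /eqP.
  rewrite subr_eq add0r => /eqP <-.
  by rewrite mulrDl; lra.
(* If [g > 0], complementarity gives [mu = 0], and stationarity would make the sum of [phi'(g) > 0]
   and [H'(g) >= 0] vanish. *)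
have gE : g = 0.
  apply/eqP; rewrite eq_le g0 andbT leNgt; apply/negP => gpos.
  have mu_eq0 : mu = 0.
    by move/eqP: mug; rewrite mulf_eq0 (gt_eqF gpos) orbF => /eqP.
  have := derive1_convex_ge0 H_diff H_incr H_conv gpos.
  move: stat; rewrite /slope gt_eqF// mu_eq0 subr0.
  have : 0 < (q ^+ 2 * g + (q - p ^+ 2)) / (1 + q * g) ^+ 2.
    by rewrite divr_gt0 ?exprn_gt0//; move: hp; rewrite expr2; lra.
  by lra.
move: hp; rewrite /objective gE !mulr0 addr0 mulr1 mul0r mulr0 ln1 mulr0 !add0r.
move=> hp.
have := smooth_part_ge0 q_gt0 y0 (ltW hp).
suff : H 0 <= H y by lra.
have [->//|yn0] := eqVneq y 0.
by apply/ltW/H_incr; rewrite ?in_itv/= ?lexx ?andbT// lt_neqAle eq_sym yn0.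
Qed.
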